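(* Let $\mathbf{f}_1,\mathbf{f}_2$ be uniform distributions with supports $\mathrm{supp}(\mathbf{f}_1)$ and $\mathrm{supp}(\mathbf{f}_2)$ respectively, governing the plant models of the systems $\Sigma_1,\Sigma_2$ respectively. Then for all $q\ge1$, $$\mathrm{dist}^{q}_{\Sigma_1,\Sigma_2,\delta_g}\ \le\ \inf_{\pi_{\mathbf f}\in\Pi(\mathbf f_1,\mathbf f_2)}\left(\sup_{\Sigma_1\in\mathrm{supp}(\mathbf f_1),\ \Sigma_2\in\mathrm{supp}(\mathbf f_2)}\delta_g(\Sigma_1,\Sigma_2)\right)^q.$$
   Context: A plant model is a state-space triple $\Sigma=(A,B,C)$ with $A\in\mathbb{R}^{n\times n}$, $B\in\mathbb{R}^{n\times m}$, $C\in\mathbb{R}^{l\times n}$, i.e. $\dot x=Ax+Bu$, $y=Cx$, regarded as a point of $\mathbb{R}^{n^2+nm+ln}$; its transfer function is $\mathbf{TF}(\Sigma)(s)=C(sI-A)^{-1}B$. $\mathbf f_1,\mathbf f_2$ are Borel probability measures on this space of plant models. Gap metric: let $\mathcal{H}_2$ be the space of Fourier transforms of $\mathcal{L}_2$ (finite-energy, vector-valued) signals supported on positive time. For a plant with real rational transfer matrix $P$, take a normalized right coprime factorisation $P=ND^{-1}$, where $N,D$ are proper, stable, real rational matrices, there are proper stable rational $X,Y$ with $XN+YD=I$, and $N^\star N+D^\star D=I$ (on the imaginary axis). The graph of $P$ is the closed subspace $\mathcal{G}_P=\{(u,y)\in\mathcal{H}_2\times\mathcal{H}_2: y=Pu\}=\begin{bmatrix}D\\N\end{bmatrix}\mathcal{H}_2$,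 and $\Pi_{\mathcal{G}_P}$ is the orthogonal projection onto it. The gap metric is $\delta_g(P_1,P_2)=\|\Pi_{\mathcal{G}_{P_1}}-\Pi_{\mathcal{G}_{P_2}}\|$ (operator norm), and for state-space models $\delta_g(\Sigma_1,\Sigma_2)$ means $\delta_g(\mathbf{TF}(\Sigma_1),\mathbf{TF}(\Sigma_2))$. $\Pi(\mathbf f_1,\mathbf f_2)$ is the set of all joint distributions with marginals $\mathbf f_1$ and $\mathbf f_2$. The type-$q$ inter-system distance is $$\mathrm{dist}^{q}_{\Sigma_1,\Sigma_2,\delta_g}:=\inf_{\pi_{\mathbf f}\in\Pi(\mathbf f_1,\mathbf f_2)}\int_{\mathrm{supp}(\mathbf f_1)\times\mathrm{supp}(\mathbf f_2)}\delta_g(\Sigma_1,\Sigma_2)^q\,\pi_{\mathbf f}(d\Sigma_1,d\Sigma_2)$$ (the superscript $q$ is part of the notation; no $q$-th root is taken). *)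

(* Defs.v *)
From HB Require Import structures.
From mathcomp Require Import all_boot all_order all_algebra.
From mathcomp Require Import all_classical all_reals all_analysis.
From mathcomp Require Import complex.

Set Implicit Arguments.
Unset Strict Implicit.
Unset Printing Implicit Defensive.

Import Order.TTheory GRing.Theory Num.Theory.
Import numFieldNormedType.Exports.

Local Open Scope classical_set_scope.
Local Open Scope ring_scope.
Local Open Scope complex_scope.

(* A signal, or a function on the imaginary axis, with values in C^k is a
   function R -> 'cV[R[i]]_k; in the latter case the real argument w stands
   for the point iw.  Elements of L2 are represented by functions, so that
   equality in L2 is equality almost everywhere. *)
Section L2.
Variable R : realType.
Local Notation C := R[i].
Local Notation mu := (@lebesgue_measure R).

Definition cintegral (D : set R) (f : R -> C) : C :=
  (Rintegral mu D (fun t => complex.Re (f t))) +i*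
  (Rintegral mu D (fun t => complex.Im (f t))).

Definition normC2 (z : C) : R := complex.Re z ^+ 2 + complex.Im z ^+ 2.

Definition cexpi (x : R) : C := cos x +i* sin x.

Variable k : nat.
Implicit Types f g u : R -> 'cV[C]_k.

Definition L2 : set (R -> 'cV[C]_k) := [set f | forall i : 'I_k,
  (fun t => complex.Re (f t i 0)) \in Lfun mu 2%:E /\
  (fun t => complex.Im (f t i 0)) \in Lfun mu 2%:E].

Definition L2norm2 f : \bar R :=
  (\int[mu]_t (\sum_(i < k) normC2 (f t i 0))%:E)%E.

Definition L2norm f : \bar R := sqrte (L2norm2 f).

Definition L2dot f g : C :=
  cintegral setT (fun t => \sum_(i < k) f t i 0 * (g t i 0)^*%C).

(* w |-> \int_0^T u(t) exp(-iwt) dt *)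
Definition truncated_fourier u (T : R) : R -> 'cV[C]_k := fun w =>
  \col_i cintegral `[0, T] (fun t => cexpi (- (w * t)) * u t i 0).

(* For u in L2 supported on positive time the integral defining the Fourier
   transform need not converge pointwise; v is its limit in L2 (Plancherel). *)
Definition is_fourier u (v : R -> 'cV[C]_k) : Prop :=
  L2norm2 (fun w => v w - truncated_fourier u T w) @[T --> +oo] --> 0%E.

Definition H2 : set (R -> 'cV[C]_k) := [set v | L2 v /\
  exists u, [/\ L2 u, forall t, t < 0 -> u t = 0 & is_fourier u v]].

(* Orthogonal projection onto a closed subspace G, defined up to a.e. equality. *)
Definition orthproj (G : set (R -> 'cV[C]_k)) f : R -> 'cV[C]_k :=
  xget (cst 0) [set g | G g /\
    forall h, G h -> L2dot (fun w => f w - g w) h = 0].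

(* The norm of an operator on the Hilbert space H2. *)
Definition H2opnorm (T : (R -> 'cV[C]_k) -> (R -> 'cV[C]_k)) : \bar R :=
  ereal_sup [set L2norm (T f) | f in [set f | H2 f /\ (L2norm f <= 1)%E]].

End L2.

Section Gap.
Variables (R : realType) (m l : nat).
Local Notation C := R[i].
Local Notation mu := (@lebesgue_measure R).

(* {(u, y) in H2 x H2 : y = P u}, the pair (u, y) being stacked in C^(m + l).
   The equation holds almost everywhere on the imaginary axis, so the finitely
   many poles of a rational P there play no role. *)
Definition graph (P : C -> 'M[C]_(l, m)) : set (R -> 'cV[C]_(m + l)) :=
  [set v | H2 v /\
    {ae mu, forall w : R, dsubmx (v w) = P (0 +i* w) *m usubmx (v w)}].

Definition gap (P1 P2 : C -> 'M[C]_(l, m)) : \bar R :=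
  H2opnorm (fun f : R -> 'cV[C]_(m + l) =>
    fun w => orthproj (graph P1) f w - orthproj (graph P2) f w).

End Gap.

Section Plant.
Variables (R : realType) (n m l : nat).
Local Notation C := R[i].

(* The triples (A, B, C), with the product topology, i.e. R^(n^2 + nm + ln). *)
Definition plant : Type := ('M[R]_n * 'M[R]_(n, m) * 'M[R]_(l, n))%type.

Definition borel_plant := g_sigma_algebraType (@open plant).

(* s is a regular point when it is not an eigenvalue of A; invmx takes a
   default value at the finitely many other points. *)
Definition TF (S : plant) (s : C) : 'M[C]_(l, m) :=
  let: (A, B, C0) := S in
  map_mx (real_complex R) C0 *m invmx (s%:M - map_mx (real_complex R) A)
    *m map_mx (real_complex R) B.

Definition ssgap (S1 S2 : plant) : \bar R := gap (TF S1) (TF S2).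

Definition mxle p q (a b : 'M[R]_(p, q)) : Prop := forall i j, a i j <= b i j.

Definition mxvol p q (a b : 'M[R]_(p, q)) : R :=
  \prod_(i < p) \prod_(j < q) (b i j - a i j).

Definition plant_le (a b : plant) : Prop :=
  [/\ mxle a.1.1 b.1.1, mxle a.1.2 b.1.2 & mxle a.2 b.2].

Definition plant_box (a b : plant) : set plant :=
  [set x | plant_le a x /\ plant_le x b].

Definition plant_vol (a b : plant) : R :=
  mxvol a.1.1 b.1.1 * mxvol a.1.2 b.1.2 * mxvol a.2 b.2.

(* Lebesgue outer measure on R^(n^2 + nm + ln), by countable covers by boxes;
   on Borel sets it is Lebesgue measure. *)
Definition plant_lebesgue (E : set plant) : \bar R :=
  ereal_inf [set s | exists (K : set nat) (a b : nat -> plant),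
    [/\ forall k, K k -> plant_le (a k) (b k),
        E `<=` \bigcup_(k in K) plant_box (a k) (b k) &
        s = (\esum_(k in K) (plant_vol (a k) (b k))%:E)%E]].

Implicit Types f : probability borel_plant R.

Definition supp f : set plant :=
  [set x | forall U : set plant, open U -> U x -> (0 < f U)%E].

Definition uniform_on_supp f : Prop :=
  [/\ (0 < plant_lebesgue (supp f))%E, (plant_lebesgue (supp f) < +oo)%E &
      forall E : set borel_plant, measurable E ->
        f E = (plant_lebesgue (E `&` supp f) *
               ((fine (plant_lebesgue (supp f)))^-1)%:E)%E].

Definition couplings f1 f2 : set (probability (borel_plant * borel_plant)%type R) :=
  [set pi | forall E : set borel_plant, measurable E ->
    pushforward pi fst E = f1 E /\ pushforward pi snd E = f2 E].

Definition intersystem_dist (q : R) f1 f2 : \bar R :=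
  ereal_inf [set (\int[pi]_(x in supp f1 `*` supp f2)
                   (ssgap x.1 x.2 `^ q))%E | pi in couplings f1 f2].

End Plant.

(* Main.v *)
Require Import Defs.
From HB Require Import structures.
From mathcomp Require Import all_boot all_order all_algebra.
From mathcomp Require Import all_classical all_reals all_analysis.
From mathcomp Require Import complex.

Set Implicit Arguments.
Unset Strict Implicit.
Unset Printing Implicit Defensive.

Import Order.TTheory GRing.Theory Num.Theory.
Import numFieldNormedType.Exports.

Local Open Scope classical_set_scope.
Local Open Scope ring_scope.

(** The inequality holds coupling by coupling: against a probability measure pi,
the integral of a nonnegative function is at most any upper bound of that
function, and on supp f1 x supp f2 the function ssgap ^ q is bounded by the
q-th power of the supremum of ssgap ([ge0_integral_le_prob]).  Taking the
infimum over the couplings on both sides gives the theorem.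

Bounding ssgap ^ q this way uses monotonicity of the power function, which
holds on nonnegative extended reals only.  The gap is nonnegative because the
supremum defining the operator norm ranges over a nonempty set: the zero
function belongs to H2 and has norm 0 ([H2opnorm_ge0]). *)

(** The integral of a nonnegative function is the supremum of the integrals of
the simple functions below it, and these all lie below the constant M too.
The function f is arbitrary because the lemma is meant for the gap, a supremum
over an uncountable family, whose measurability in the plants is unclear. *)
Lemma ge0_integral_le_prob d (T : measurableType d) (R : realType)
    (P : probability T R) (D : set T) (f : T -> \bar R) (M : \bar R) :
  (0 <= M)%E -> (forall x, D x -> (0 <= f x)%E) ->
  (forall x, D x -> (f x <= M)%E) ->
  (\int[P]_(x in D) f x <= M)%E.
Proof.
move=> M0 f0 fM.
have <- : (\int[P]_x cst M x = M)%E.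
  rewrite integral_cst// -[RHS]mule1; congr (_ * _)%E.
  exact: probability_setT.
rewrite ge0_integralE// ge0_integralTE//.
(* A simple function below f on D and below 0 elsewhere is below M. *)
apply: ereal_sup_le => _ [h hf <-]; exists h => // x /=.
apply: le_trans (hf x) _.
by rewrite patchE; case: ifPn => [/set_mem/fM//|_].
Qed.

Section Nonneg.
Variables (R : realType) (k : nat).
Local Notation C := R[i].
Local Notation zero := (cst 0 : R -> 'cV[C]_k).

Lemma L2norm2_0 : L2norm2 zero = 0%E.
Proof.
rewrite /L2norm2 -[RHS](@integral0 _ _ _ (@lebesgue_measure R) setT).
apply: eq_integral => t _; rewrite big1// => i _.
by rewrite /normC2 mxE /= expr0n addr0.
Qed.

Lemma L2_0 : L2 zero.
Proof.
move=> i.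
have z0 : (fun=> 0 : R) \in Lfun (@lebesgue_measure R) 2%:E.
  have p1 : (1 <= 2%:E :> \bar R)%E by rewrite lee_fin ler1n.
  by have [] := Lfun_addr_closed (@lebesgue_measure R) p1.
split; rewrite (_ : (fun t => _) = (fun=> 0)) //;
  by apply/funext => t; rewrite mxE.
Qed.

Lemma truncated_fourier0 (T : R) : truncated_fourier zero T = zero.
Proof.
apply/funext => w; apply/matrixP => i j; rewrite !mxE /cintegral.
have int0 (g : R -> R) : (forall t, g t = 0) ->
    Rintegral (@lebesgue_measure R) `[0, T] g = 0.
  move=> g0; rewrite /Rintegral (_ : (fun x => _) = cst 0%E) ?integral0//.
  by apply/funext => t; rewrite /= g0.
by rewrite !int0 ?mxE// => t; rewrite mxE mulr0.
Qed.

(** The zero function is the Fourier transform of the zero signal, whose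
truncated transforms all vanish. *)
Lemma H2_0 : H2 zero.
Proof.
split; first exact: L2_0.
exists zero; split => //; first exact: L2_0.
rewrite /is_fourier (_ : (fun T => _) = cst 0%E); first exact: cvg_cst.
apply/funext => T; rewrite truncated_fourier0 -[RHS]L2norm2_0.
by congr L2norm2; apply/funext => w; rewrite /= subr0.
Qed.

(** For an arbitrary T, linear or not, the norm of the value of T at the zero
function is one of the nonnegative numbers in the supremum. *)
Lemma H2opnorm_ge0 (T : (R -> 'cV[C]_k) -> R -> 'cV[C]_k) : (0 <= H2opnorm T)%E.
Proof.
apply: le_trans (sqrte_ge0 (L2norm2 (T zero))) _.
apply: ereal_sup_ubound; exists zero => //; split; first exact: H2_0.
by rewrite /L2norm L2norm2_0 /= sqrtr0.
Qed.

End Nonneg.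

Theorem mainTheorem5 (R : realType) (n m l : nat)
  (f1 f2 : probability (borel_plant R n m l) R)
  (hf1 : uniform_on_supp f1) (hf2 : uniform_on_supp f2)
  (q : R) (hq : 1 <= q) :
  (intersystem_dist q f1 f2 <=
   ereal_inf [set (ereal_sup [set ssgap S.1 S.2 | S in supp f1 `*` supp f2]) `^ q
             | _ in couplings f1 f2])%E.
Proof.
apply: le_ereal_inf_tmp => _ [pi pi12 <-].
apply: ge_ereal_inf; exists (\int[pi]_(x in supp f1 `*` supp f2)
  (ssgap x.1 x.2 `^ q))%E; first by exists pi.
apply: ge0_integral_le_prob => [|x _|x Dx]; [exact: poweR_ge0..|].
have gapx : (0 <= ssgap x.1 x.2)%E by exact: H2opnorm_ge0.
have le_sup : (ssgap x.1 x.2 <=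
    ereal_sup [set ssgap S.1 S.2 | S in supp f1 `*` supp f2])%E.
  by apply: ereal_sup_ubound; exists x.
apply: gt0_ler_poweR => //.
- exact: le_trans hq.
- by rewrite in_itv /= gapx leey.
- by rewrite in_itv /= leey (le_trans gapx).
Qed.
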